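(* The pseudocomplemented complete lattices as objects, together with the sets $Gal(A,B)$ of Galois maps as hom-sets and the composition $\odot$, form a semicategory. Its largest subcategory (the full subsemicategory on all objects that possess an identity morphism) is that of ABC-lattices, i.e. of atomic boolean complete lattices, and this category is equivalent to the category of sets with relations as morphisms.
   Context: A semicategory satisfies the axioms of a category except that identity morphisms need not exist: it has objects, hom-sets and an associative composition. An identity morphism of an object $B$ is a morphism $B\to B$ that is neutral for all compositions with morphisms into and out of $B$. A complete lattice is pseudocomplemented if for each $x$ there is a greatest $y$ with $x\wedge y=0$. For complete lattices $A,B$, $Gal(A,B)$ is the set of Galois maps, i.e. maps $f:A\to B$ with $f(\bigvee X)=\bigwedge f[X]$ for all $X\subseteq A$. For complete lattices $A,C$, a tensor in $A\times C$ is a down-set $T$ of $A\times C$ (componentwise order) such that $X\times Z\subseteq T$ implies $(\bigvee X,\bigvee Z)\in T$ for all $X\subseteq A$, $Z\subseteq C$. For $f\in Gal(A,B)$ and $g\in Gal(B,C)$, let $T_{f,g}=\{(x,z)\in A\times C:\exists y\in B\setminus\{0_B\}\ (f(x)\ge y\text{ and }g(y)\ge z)\}$, let $E_{f,g}$ be the least tensor in $A\times C$ containing $T_{f,g}$, and define $g\odot f:A\to C$ by $g\odot f(a)=\bigvee\{c\in C:(a,c)\in E_{f,g}\}$. In the category of sets and relations, morphisms $X\to Y$ are subsets of $X\times Y$, composed by the relation product. *)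

(* Defs.v *)
From mathcomp Require Import all_boot all_order.
From mathcomp Require Import boolp classical_sets.

Set Implicit Arguments.
Unset Strict Implicit.
Unset Printing Implicit Defensive.

Import Order.TTheory.

Local Open Scope classical_set_scope.
Local Open Scope order_scope.

(* Only the data are bundled: associativity and the existence of identity
   morphisms are the separate predicates [is_semicategory], [is_category]. *)
Record semicat := Semicat {
  obj :> Type;
  hom : obj -> obj -> Type;
  comp : forall A B C : obj, hom B C -> hom A B -> hom A C }.

Arguments hom : clear implicits.
Arguments comp {s A B C} g f.

Definition is_semicategory (S : semicat) : Prop :=
  forall (A B C D : S) (f : hom S A B) (g : hom S B C) (h : hom S C D),
    comp h (comp g f) = comp (comp h g) f.

Definition is_identity (S : semicat) (B : S) (i : hom S B B) : Prop :=
  (forall (A : S) (f : hom S A B), comp i f = f) /\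
  (forall (C : S) (g : hom S B C), comp g i = g).

Definition has_identity (S : semicat) (B : S) : Prop :=
  exists i : hom S B B, is_identity i.

Definition is_category (S : semicat) : Prop :=
  is_semicategory S /\ forall B : S, has_identity B.

Definition full_sub (S : semicat) (P : S -> Prop) : semicat :=
  {| obj := {B : S | P B};
     hom A B := hom S (sval A) (sval B);
     comp _ _ _ g f := comp g f |}.

Arguments full_sub : clear implicits.

Record functor (S S' : semicat) := Functor {
  fobj :> S -> S';
  fmap : forall A B : S, hom S A B -> hom S' (fobj A) (fobj B);
  fmap_comp : forall (A B C : S) (g : hom S B C) (f : hom S A B),
    fmap (comp g f) = comp (fmap g) (fmap f);
  fmap_identity : forall (B : S) (i : hom S B B),
    is_identity i -> is_identity (fmap i) }.

Arguments fmap {S S'} f0 {A B} _.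

Program Definition functor_id (S : semicat) : functor S S :=
  {| fobj B := B; fmap _ _ f := f |}.

Program Definition functor_comp (S S' S'' : semicat)
    (G : functor S' S'') (F : functor S S') : functor S S'' :=
  {| fobj B := G (F B); fmap _ _ f := fmap G (fmap F f) |}.
Next Obligation. by move=> *; rewrite !fmap_comp. Qed.
Next Obligation. by move=> *; do 2!apply: fmap_identity. Qed.

Definition is_iso (S : semicat) (A B : S) (f : hom S A B) : Prop :=
  exists g : hom S B A, is_identity (comp g f) /\ is_identity (comp f g).

Definition naturally_isomorphic (S S' : semicat) (F G : functor S S') : Prop :=
  exists eta : forall B : S, hom S' (F B) (G B),
    (forall B : S, is_iso (eta B)) /\
    (forall (A B : S) (f : hom S A B),
       comp (eta B) (fmap F f) = comp (fmap G f) (eta A)).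

Definition equivalent_categories (S S' : semicat) : Prop :=
  [/\ is_category S, is_category S' &
      exists (F : functor S S') (G : functor S' S),
        naturally_isomorphic (functor_comp G F) (functor_id S) /\
        naturally_isomorphic (functor_comp F G) (functor_id S')].

Section Lattices.
Context {d : Order.disp_t} (L : tbLatticeType d).

Definition complete_lattice : Prop := forall X : set L, supremums X !=set0.

Definition pseudocomplemented : Prop :=
  forall x : L, exists y : L,
    Order.meet x y = \bot /\ forall z : L, Order.meet x z = \bot -> z <= y.

Definition boolean_lattice : Prop :=
  left_distributive (@Order.meet d L) (@Order.join d L) /\
  forall x : L, exists y : L, Order.meet x y = \bot /\ Order.join x y = \top.

Definition atom (a : L) : Prop :=
  a != \bot /\ forall x : L, x <= a -> x = \bot \/ x = a.

Definition atomic : Prop :=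
  forall x : L, x != \bot -> exists2 a : L, atom a & a <= x.

(* [supremum] and [infimum] return their first argument on the empty set. *)
Definition bigjoin (X : set L) : L := supremum \bot X.
Definition bigmeet (X : set L) : L := infimum \top X.

Hypothesis L_complete : complete_lattice.

Lemma bigjoinP (X : set L) : supremums X (bigjoin X).
Proof.
rewrite /bigjoin /supremum; case: ifPn => [/eqP ->|_].
  by split=> [x []|x _]; apply: le0x.
exact: xgetPex (L_complete X).
Qed.

Lemma bigjoin1 (x : L) : bigjoin [set x] = x.
Proof. exact: supremum1. Qed.

Lemma bigmeetP (X : set L) : infimums X (bigmeet X).
Proof.
rewrite /bigmeet /infimum; case: ifPn => [/eqP ->|_].
  by split=> [x []|x _]; apply: lex1.
have [ub lub] := bigjoinP (lbound X).
apply: (@xgetPex _ \top (infimums X)); exists (bigjoin (lbound X)).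
by split=> // x Xx; apply: lub => y; apply.
Qed.

End Lattices.

Section Galois.
Context {d d' : Order.disp_t} {A : tbLatticeType d} {B : tbLatticeType d'}.

Definition galois (f : A -> B) : Prop :=
  forall X : set A, f (bigjoin X) = bigmeet (f @` X).

Definition tensor (T : set (A * B)) : Prop :=
  (forall (a a' : A) (b b' : B), a' <= a -> b' <= b -> T (a, b) -> T (a', b')) /\
  (forall (X : set A) (Z : set B), X `*` Z `<=` T -> T (bigjoin X, bigjoin Z)).

Lemma smallest_tensor (U : set (A * B)) : tensor (smallest tensor U).
Proof.
split=> [a a' b b' lea leb UT T|X Z XZ T] [tT subT].
  by apply: (tT.1 _ _ _ _ lea leb); apply: UT.
by apply: tT.2 => p /XZ; apply.
Qed.

End Galois.

Section Odot.
Context {dA dB dC : Order.disp_t}.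
Context {A : tbLatticeType dA} {B : tbLatticeType dB} {C : tbLatticeType dC}.

Definition T_ (f : A -> B) (g : B -> C) : set (A * C) :=
  [set p | exists y : B, [/\ y != \bot, y <= f p.1 & p.2 <= g y]].

Definition E_ (f : A -> B) (g : B -> C) : set (A * C) :=
  smallest tensor (T_ f g).

Definition odot (g : B -> C) (f : A -> B) : A -> C :=
  fun a => bigjoin [set c | E_ f g (a, c)].

Lemma odot_galois (g : B -> C) (f : A -> B) :
  complete_lattice A -> complete_lattice C -> galois (odot g f).
Proof.
move=> cA cC X; have [downE supE] := smallest_tensor (T_ f g).
have Ea a : E_ f g (a, odot g f a).
  by rewrite -{1}[a]bigjoin1; apply: supE => -[x c] /= [->].
have leE a c : E_ f g (a, c) -> c <= odot g f a by apply: (bigjoinP cC _).1.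
have [lbX glbX] := bigmeetP cC (odot g f @` X).
apply/eqP; rewrite eq_le; apply/andP; split.
  apply: glbX => _ [x Xx <-]; apply: leE; apply: downE (Ea (bigjoin X)) => //.
  exact: (bigjoinP cA X).1.
apply: leE; rewrite -[bigmeet _]bigjoin1; apply: supE => -[x c] /= [Xx ->].
by apply: downE (Ea x) => //; apply: lbX; exists x.
Qed.

End Odot.

Record pcLattice := PcLattice {
  pc_disp : Order.disp_t;
  pc_sort :> tbLatticeType pc_disp;
  pc_complete : complete_lattice pc_sort;
  pc_pseudocomplemented : pseudocomplemented pc_sort }.

Definition Gal (A B : pcLattice) : Type := {f : A -> B | galois f}.

Definition Gal_comp (A B C : pcLattice) (g : Gal B C) (f : Gal A B) : Gal A C :=
  exist _ (odot (sval g) (sval f))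
    (odot_galois (sval g) (sval f) (@pc_complete A) (@pc_complete C)).

Definition PCL : semicat :=
  {| obj := pcLattice; hom := Gal; comp := Gal_comp |}.

Definition ABC_lattice (B : pcLattice) : Prop := boolean_lattice B /\ atomic B.

Definition Rel : semicat :=
  {| obj := Type;
     hom X Y := set (X * Y);
     comp X Y Z S R := [set p | exists y : Y, R (p.1, y) /\ S (y, p.2)] |}.

(* Main.v *)
From mathcomp Require Import all_boot all_order.
From mathcomp Require Import boolp classical_sets.
Require Import Defs.

(** A Galois map [f] is the same thing as the tensor of all pairs [(a, b)] with
    [b <= f a], and the tensor of [odot g f] is the one generated by the pairs
    that are linked by a nonzero middle element.  The proof reaches the
    composition only through these pairs: [le_odot] says that they belong to it,
    and [odot_ind] is induction over the tensor that they generate.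

    Associativity: both iterated composites contain all pairs that are linked
    by a chain of two nonzero middle elements, and the point is that closing one
    of the products under joins first, before linking it with the third map,
    adds nothing to the tensor generated by these pairs.  Closing under joins
    in a middle lattice is harmless there because of pseudocomplementation: a
    nonzero element below a join meets one of the joinands
    ([meets_joinand]), so it may be replaced by a nonzero element below a
    single joinand.

    Identities: composing an identity [i] of [B] with the two-valued maps
    [step b] and [constant b] shows that two nonzero elements [x], [y] with
    [y <= i x] are equal, hence are atoms, and that every [b] is the join of the
    atoms below it.  For a pseudocomplemented complete lattice, being atomistic
    in this sense is the same as being atomic and boolean ([ABC_atomistic]).
    Conversely, in an atomistic lattice the map [diagonal] sending [b] to the
    meet of the atoms below it, whose tensor is generated by the pairs [(p, p)]
    with [p] an atom, is an identity.

    Equivalence: a Galois map between atomistic lattices is determined by its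
    restriction to atoms, a relation, and every relation between atoms arises
    in this way; under this correspondence [odot] is the relation product
    because atoms are completely join prime.  Since the powerset of [X] has
    the atom set [X] up to bijection, taking atoms is a full, faithful and
    essentially surjective functor. *)

Set Implicit Arguments.
Unset Strict Implicit.
Unset Printing Implicit Defensive.

Import Order.TTheory.

Local Open Scope classical_set_scope.
Local Open Scope order_scope.

(** * Semicategories, and equivalences from full faithful functors *)

Lemma identity_unique (S : semicat) (B : S) (i j : hom S B B) :
  is_identity i -> is_identity j -> i = j.
Proof. by move=> [iL _] [_ jR]; rewrite -(iL B j) jR. Qed.

Lemma identity_full_sub (S : semicat) (P : S -> Prop) (B : full_sub S P)
    (i : hom S (sval B) (sval B)) :
  is_identity i -> @is_identity (full_sub S P) B i.
Proof. by move=> [iL iR]; split=> [A f|C g]; [apply: iL|apply: iR]. Qed.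

Section FullyFaithful.
Context {S S' : semicat} (F : functor S S').
Hypothesis faithful : forall (A B : S) (f g : hom S A B),
  fmap F f = fmap F g -> f = g.

Lemma faithful_reflects_identity (B : S) (i : hom S B B) :
  is_identity (fmap F i) -> is_identity i.
Proof.
move=> [iL iR]; split=> [A f|C g]; apply: faithful; rewrite fmap_comp.
  exact: iL.
exact: iR.
Qed.

Hypothesis full : forall (A B : S) (h : hom S' (F A) (F B)),
  exists f : hom S A B, fmap F f = h.

Lemma fully_faithful_reflects_iso (A B : S) (f : hom S A B) :
  is_iso (fmap F f) -> is_iso f.
Proof.
move=> [g' [g'f fg']]; have [g defg] := full g'; exists g.
by split; apply: faithful_reflects_identity; rewrite fmap_comp defg.
Qed.

Hypothesis ess_surjective : forall Y : S', exists (X : S) (e : hom S' (F X) Y),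
  is_iso e.

(** The quasi-inverse sends [Y] to a chosen [X] with an isomorphism
    [e : F X -> Y], and a morphism [h : Y -> Z] to the preimage under [F] of its
    conjugate by these isomorphisms. *)
Lemma fully_faithful_equivalence :
  is_category S -> is_category S' -> equivalent_categories S S'.
Proof.
move=> catS catS'; split=> //.
have [assoc' _] := catS'.
have /choice[Go] := ess_surjective.
move=> /(_ _)/cid-/all_sig[e /(_ _)/cid-/all_sig[e' invE]].
have e'e Y : is_identity (comp (e' Y) (e Y)) by case: (invE Y).
have ee' Y : is_identity (comp (e Y) (e' Y)) by case: (invE Y).
pose Gm Y Z (h : hom S' Y Z) : hom S (Go Y) (Go Z) :=
  sval (cid (full (comp (e' Z) (comp h (e Y))))).
have FG Y Z (h : hom S' Y Z) : fmap F (Gm Y Z h) = comp (e' Z) (comp h (e Y)).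
  by rewrite /Gm; case: cid.
have eFG Y Z (h : hom S' Y Z) : comp (e Z) (fmap F (Gm Y Z h)) = comp h (e Y).
  by rewrite FG assoc'; apply: (ee' Z).1.
have Gcomp X Y Z (k : hom S' Y Z) (h : hom S' X Y) :
    Gm X Z (comp k h) = comp (Gm Y Z k) (Gm X Y h).
  apply: faithful; rewrite fmap_comp (FG _ _ k) (FG _ _ (comp k h)).
  by rewrite -!assoc' eFG.
have Gid Y (i : hom S' Y Y) : is_identity i -> is_identity (Gm Y Y i).
  by move=> [iL _]; apply: faithful_reflects_identity; rewrite FG iL.
exists F, (Functor Gcomp Gid); split.
  pose eta B : hom S (Go (F B)) B := sval (cid (full (e (F B)))).
  have Feta B : fmap F (eta B) = e (F B) by rewrite /eta; case: cid.
  exists eta; split=> [B|A B f].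
    apply: (@fully_faithful_reflects_iso _ _ (eta B)).
    by rewrite Feta; exists (e' (F B)).
  by apply: faithful; rewrite /= !fmap_comp !Feta eFG.
exists e; split=> [Y|Y Z h]; last exact: eFG.
by exists (e' Y); apply: invE.
Qed.

End FullyFaithful.

(** * Complete lattices, Galois maps and the composition *)

Section CompleteLattice.
Context {d : Order.disp_t} {L : tbLatticeType d}.
Hypothesis cL : complete_lattice L.

Lemma bigjoin_le (X : set L) (b : L) :
  bigjoin X <= b <-> forall x, X x -> x <= b.
Proof.
have [ub lub] := bigjoinP cL X; split=> [Xb x Xx|Xb]; last exact: lub.
exact: le_trans (ub x Xx) Xb.
Qed.

Lemma le_bigjoin (X : set L) (x : L) : X x -> x <= bigjoin X.
Proof. by have /bigjoin_le := lexx (bigjoin X); apply. Qed.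

Lemma le_bigmeet (X : set L) (b : L) :
  b <= bigmeet X <-> forall x, X x -> b <= x.
Proof.
have [lb glb] := bigmeetP cL X; split=> [bX x Xx|bX]; last exact: glb.
exact: le_trans bX (lb x Xx).
Qed.

(** Otherwise the pseudocomplement of [x] would bound all of [X], hence also
    [x] itself. *)
Lemma meets_joinand (X : set L) (x : L) : pseudocomplemented L ->
  x != \bot -> x <= bigjoin X -> exists2 y, X y & Order.meet x y != \bot.
Proof.
move=> pcL x0 xX; apply: contrapT => noy; case/negP: x0.
have [x' [xx' maxx']] := pcL x.
have Xx' : bigjoin X <= x'.
  apply/bigjoin_le => y Xy; apply: maxx'; apply: contrapT => /eqP xy0.
  by apply: noy; exists y.
by rewrite -xx' eq_sym; apply/eqP/meet_l/(le_trans xX Xx').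
Qed.

Lemma atom_le_eq (p q : L) : atom p -> atom q -> p <= q -> p = q.
Proof. by move=> [p0 _] [_ minq] /minq[pE|//]; rewrite pE eqxx in p0. Qed.

Lemma atom_prime (X : set L) (p : L) : pseudocomplemented L ->
  atom p -> p <= bigjoin X -> exists2 x, X x & p <= x.
Proof.
move=> pcL [p0 minp] pX; have [x Xx px0] := meets_joinand pcL p0 pX.
exists x => //; have [pxE|<-] := minp _ (leIl p x); last exact: leIr.
by rewrite pxE eqxx in px0.
Qed.

End CompleteLattice.

Section GaloisMaps.
Context {d d' : Order.disp_t} {A : tbLatticeType d} {B : tbLatticeType d'}.
Hypotheses (cA : complete_lattice A) (cB : complete_lattice B).
Implicit Type f : A -> B.

Lemma galoisP f : galois f <->
  forall X b, b <= f (bigjoin X) <-> forall x, X x -> b <= f x.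
Proof.
split=> [gf X b|gf X].
  rewrite gf; split=> [/(le_bigmeet cB) bX x Xx|bX].
    by apply: bX; exists x.
  by apply/(le_bigmeet cB) => _ [x Xx <-]; apply: bX.
apply/eqP; rewrite eq_le; apply/andP; split.
  by apply/(le_bigmeet cB) => _ [x Xx <-]; apply: (gf X _).1 Xx.
apply/gf => x Xx; apply: (le_bigmeet cB _ _).1 (lexx _) _ _.
by exists x.
Qed.

Lemma le_galois_bigjoin f (X : set A) (b : B) :
  galois f -> (forall x, X x -> b <= f x) -> b <= f (bigjoin X).
Proof. by move=> /galoisP gf bX; apply/gf. Qed.

Lemma galois_anti f : galois f -> {homo f : x y / x <= y >-> y <= x}.
Proof.
move=> /galoisP gf x y xy.
suff yE : y = bigjoin [set x; y].
  by rewrite {1}yE; apply: (gf _ _).1 (lexx _) _ _; left.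
apply/eqP; rewrite eq_le (le_bigjoin cA) /=; last by right.
by apply/(bigjoin_le cA) => _ [->|->].
Qed.

Lemma galois_tensor f : galois f -> tensor [set p | p.2 <= f p.1].
Proof.
move=> gf; split=> [a a' b b' /= lea leb ba|X Z XZ /=].
  exact: le_trans leb (le_trans ba (galois_anti gf lea)).
apply/(bigjoin_le cB) => z Zz; apply: le_galois_bigjoin gf _ => x Xx.
exact: (XZ (x, z)).
Qed.

(** The tensor of [step b] is generated by the single pair [(b, \top)]. *)
Definition step (b : A) : A -> B := fun a => if a <= b then \top else \bot.

Lemma step_galois (b : A) : galois (step b).
Proof.
apply/galoisP => X c; rewrite /step; case: ifPn => [Xb|Xb].
  by split=> // _ x Xx; rewrite ((bigjoin_le cA _ _).1 Xb).
split=> [c0 x _|cX]; first by rewrite (le_trans c0).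
apply: contrapT => c0; case/negP: Xb; apply/(bigjoin_le cA) => x Xx.
by move: (cX x Xx); case: ifP.
Qed.

(** The tensor of [constant b] is generated by the single pair [(\top, b)]. *)
Definition constant (b : B) : A -> B := fun a => if a == \bot then \top else b.

Lemma constant_galois (b : B) : galois (constant b).
Proof.
apply/galoisP => X c; rewrite /constant; case: eqP => [X0|X0].
  split=> // _ x Xx; case: eqP => // -[]; apply/eqP.
  by rewrite -lex0 -X0 (le_bigjoin cA).
split=> [cb x _|cX]; first by case: ifP.
apply: contrapT => cb; apply: X0; apply/eqP; rewrite -lex0.
apply/(bigjoin_le cA) => x Xx; move: (cX x Xx).
by case: eqP => [->|].
Qed.

End GaloisMaps.

Section Composition.
Context {dA dB dC : Order.disp_t}.
Context {A : tbLatticeType dA} {B : tbLatticeType dB} {C : tbLatticeType dC}.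
Hypotheses (cA : complete_lattice A) (cC : complete_lattice C).
Variables (f : A -> B) (g : B -> C).

Lemma le_odot (y : B) (a : A) (c : C) :
  y != \bot -> y <= f a -> c <= g y -> c <= odot g f a.
Proof.
move=> y0 yf cg; apply: (le_bigjoin cC) => T [_ subT]; apply: subT.
by exists y.
Qed.

Lemma odot_ind (T : set (A * C)) (a : A) (c : C) :
  tensor T -> T_ f g `<=` T -> c <= odot g f a -> T (a, c).
Proof.
move=> tT subT cgf; apply: (tT.1 a a _ _ (lexx a) cgf).
rewrite -[a in T (a, _)]bigjoin1; apply: tT.2 => -[x z] /= [-> Ez].
exact: Ez.
Qed.

Lemma odot_least (h : A -> C) (a : A) : galois h ->
  (forall y x z, y != \bot -> y <= f x -> z <= g y -> z <= h x) ->
  odot g f a <= h a.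
Proof.
move=> gh Th; apply: (odot_ind (galois_tensor cA cC gh)) => //.
by move=> [x z] [y [y0 yf zg]]; apply: Th y0 yf zg.
Qed.

End Composition.

Section Associativity.
Context {dA dB dC dD : Order.disp_t}.
Context {A : tbLatticeType dA} {B : tbLatticeType dB}.
Context {C : tbLatticeType dC} {D : tbLatticeType dD}.
Hypotheses (cA : complete_lattice A) (cB : complete_lattice B).
Hypotheses (cC : complete_lattice C) (cD : complete_lattice D).
Variables (f : A -> B) (g : B -> C) (h : C -> D).

(** In each of the two inclusions, the tensor to which the induction is applied
    quantifies over all nonzero elements below the middle component.  This
    makes it closed under joins in the middle lattice, by [meets_joinand]. *)
Lemma odot_assoc_le : pseudocomplemented C -> galois h ->
  forall a, odot h (odot g f) a <= odot (odot h g) f a.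
Proof.
move=> pcC gh a; set R := odot (odot h g) f.
have gR : galois R by exact: odot_galois.
apply: (odot_least cA cD) => // z x w z0 zgf whz.
pose W : set (A * C) := [set p | forall z' w,
  z' != \bot -> z' <= p.2 -> w <= h z' -> w <= R p.1].
suff Wxz : W (x, z) by exact: (Wxz z).
apply: odot_ind zgf => [|[u v] [y [y0 yf vg]] z' w' z'0 z'v w'h]; last first.
  apply: (le_odot cD y0 yf); apply: (le_odot cD z'0 _ w'h).
  exact: le_trans z'v vg.
split=> [u u' v v' lu lv Wuv z' w' z'0 z'v w'h|X Z XZ z' w' /= z'0 z'Z w'h].
  apply: le_trans (galois_anti cA cD gR lu).
  by apply: (Wuv z' w') => //; apply: le_trans z'v lv.
have [v Zv z'v0] := meets_joinand cC pcC z'0 z'Z.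
apply: (le_galois_bigjoin cD gR) => u Xu.
apply: (XZ (u, v) _ (Order.meet z' v)) => //; first exact: leIr.
by apply: le_trans w'h _; apply: (galois_anti cC cD gh); apply: leIl.
Qed.

Lemma odot_assoc_ge : pseudocomplemented B -> galois g ->
  forall a, odot (odot h g) f a <= odot h (odot g f) a.
Proof.
move=> pcB gg a; set R := odot h (odot g f).
have gR : galois R by exact: odot_galois.
apply: (odot_least cA cD) => // y x w y0 yf whg.
pose W : set (B * D) := [set p | forall y' x,
  y' != \bot -> y' <= p.1 -> y' <= f x -> p.2 <= R x].
suff Wyw : W (y, w) by exact: (Wyw y).
apply: odot_ind whg => [|[u v] [z [z0 zg vh]] y' x' y'0 y'u y'f]; last first.
  apply: (le_odot cD z0 _ vh); apply: (le_odot cC y'0 y'f).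
  exact: le_trans zg (galois_anti cB cC gg y'u).
split=> [u u' v v' lu lv Wuv y' x' y'0 y'u y'f|X Z XZ y' x' /= y'0 y'X y'f].
  by apply: le_trans lv _; apply: (Wuv y' x') => //; apply: le_trans y'u lu.
have [u Xu y'u0] := meets_joinand cB pcB y'0 y'X.
apply/(bigjoin_le cD) => v Zv.
apply: (XZ (u, v) _ (Order.meet y' u)) => //; first exact: leIr.
exact: le_trans (leIl _ _) y'f.
Qed.

End Associativity.

Lemma Gal_eq (A B : pcLattice) (f g : Gal A B) : sval f =1 sval g -> f = g.
Proof. by case: f g => [f gf] [g gg] /= fg; apply: eq_exist; exact: funext. Qed.

Lemma PCL_semicategory : is_semicategory PCL.
Proof.
move=> A B C D f g h; apply: Gal_eq => a /=; apply/eqP; rewrite eq_le.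
rewrite odot_assoc_le ?odot_assoc_ge //;
  do ?[exact: pc_complete | exact: pc_pseudocomplemented | exact: svalP].
Qed.

(** * Objects with an identity morphism *)

Definition atomistic (B : pcLattice) : Prop :=
  forall u v : B, (forall p, atom p -> p <= u -> p <= v) -> u <= v.

(** One direction compares [u] with a complement [c] of [v]: an atom below both
    would be below both [v] and [c].  In the other, atoms being prime lets
    distributivity and the complement law be tested on atoms. *)
Lemma ABC_atomistic (B : pcLattice) : ABC_lattice B <-> atomistic B.
Proof.
have [cB pcB] := (@pc_complete B, @pc_pseudocomplemented B).
split=> [[[distr compl] atB] u v uv|atB].
  have [c [vc0 vc1]] := compl v.
  have uc0 : Order.meet u c = \bot.
    apply: contrapT => /eqP /atB[p pat]; rewrite lexI => /andP[pu pc].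
    case: pat (uv p pat pu) => /negP p0 _ pv; apply: p0.
    by rewrite -lex0 -vc0 lexI pv.
  have: Order.meet (Order.join v c) u <= v.
    by rewrite distr [Order.meet c u]meetC uc0 joinx0 leIl.
  by rewrite vc1 meet1x.
have primeU (p x y : B) : atom p -> p <= Order.join x y -> p <= x \/ p <= y.
  move=> pat pxy; have /(atom_prime cB pcB pat) : p <= bigjoin [set x; y].
    apply: le_trans pxy _; rewrite leUx !(le_bigjoin cB) //; by [left|right].
  by move=> [_ [->|->]]; [left|right].
split; last first.
  move=> x x0; apply: contrapT => noat; case/negP: x0.
  rewrite -lex0; apply: atB => p pat px; case: noat; by exists p.
split=> [x y z|x].
  apply/eqP; rewrite eq_le; apply/andP; split; last first.
    by rewrite leUx !leI2 ?lexx ?leUl ?leUr.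
  apply: atB => p pat; rewrite lexI => /andP[/(primeU _ _ _ pat) pxy pz].
  by case: pxy => le_p; [apply: lexUl|apply: lexUr]; rewrite lexI le_p.
have [y [xy0 maxy]] := pcB x; exists y; split=> //.
apply/eqP; rewrite -le1x; apply: atB => p [p0 minp] _.
have [px0|<-] := minp _ (leIr p x).
  by rewrite (le_trans (maxy p px0)) ?leUr.
by rewrite (le_trans (leIl x p)) ?leUl.
Qed.

Lemma atomistic_bigjoin (B : pcLattice) (b : B) : atomistic B ->
  bigjoin [set p | atom p /\ p <= b] = b.
Proof.
have cB := @pc_complete B.
move=> atB; apply/eqP; rewrite eq_le.
apply/andP; split; first by apply/(bigjoin_le cB) => p [].
by apply: atB => p pat pb; apply: (le_bigjoin cB).
Qed.

Section IdentityGivesAtomistic.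
Context {B : pcLattice} {i : B -> B}.
Hypothesis gi : galois i.
Hypothesis iL : forall f : B -> B, galois f -> odot i f = f.
Hypothesis iR : forall g : B -> B, galois g -> odot g i = g.

Let cB := @pc_complete B.

(** The pair [(x, \top)] is linked through [y] in the product of [i] with
    [step y], which is [step y] itself.  When [\bot] and [\top] coincide this
    says nothing, but then all elements are equal. *)
Lemma identity_le_l (x y : B) : y != \bot -> y <= i x -> x <= y.
Proof.
move=> y0 yi; have := le_odot cB (g := step y) (c := \top) y0 yi.
rewrite iR /step ?lexx; last exact: step_galois.
move=> /(_ isT); case: ifP => // xy; rewrite le1x => /eqP triv.
by rewrite -xy -[x]meetx1 -triv meetx0 le0x.
Qed.

(** Dually, [(\top, y)] is linked through [x] in the product of [constant x]
    with [i]. *)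
Lemma identity_le_r (x y : B) : x != \bot -> y <= i x -> y <= x.
Proof.
move=> x0 yi.
have xc : x <= @constant _ _ B B x \top by rewrite /constant; case: ifP.
have := le_odot cB x0 xc yi.
rewrite iL; last exact: constant_galois.
rewrite /constant; case: eqP => // triv _.
by case/negP: x0; rewrite -lex0 -triv lex1.
Qed.

(** Related nonzero elements are equal, and this applies to everything nonzero
    below them too, because [i] is antitone. *)
Lemma identity_atom (x y : B) :
  x != \bot -> y != \bot -> y <= i x -> atom x /\ x = y.
Proof.
have eq_xy u v : u != \bot -> v != \bot -> v <= i u -> u = v.
  move=> u0 v0 vi; apply/eqP.
  by rewrite eq_le (identity_le_l v0 vi) (identity_le_r u0 vi).
move=> x0 y0 yi; split; last exact: eq_xy; split=> // z zx.
have [->|z0] := eqVneq z \bot; [by left|right].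
rewrite (eq_xy x y) // (eq_xy z y) //.
exact: le_trans yi (galois_anti cB cB gi zx).
Qed.

(** The product of [i] with [step u] lies in the tensor of [step v], where [v]
    bounds the atoms below [u]; as this product is [step u] itself, [u <= v]. *)
Lemma identity_atomistic : atomistic B.
Proof.
move=> u v uv.
have : odot (step u) i u <= @step _ _ B B v u.
  apply: (odot_least cB cB) => [|y x z y0 yi]; first exact: step_galois.
  rewrite /step; case: ifP => yu zy; last exact: le_trans zy (le0x _).
  suff -> : x <= v by exact: lex1.
  have [->|x0] := eqVneq x \bot; first exact: le0x.
  have [xat xy] := identity_atom x0 y0 yi.
  by apply: uv => //; rewrite xy.
rewrite iR; last exact: step_galois.
rewrite /step lexx; case: ifP => // uv0; rewrite le1x => /eqP triv.
by rewrite -uv0 -[u]meetx1 -triv meetx0 le0x.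
Qed.

End IdentityGivesAtomistic.

Section Diagonal.
Context {B : pcLattice}.

Let cB := @pc_complete B.
Let pcB := @pc_pseudocomplemented B.

Definition diagonal (b : B) : B := bigmeet [set p | atom p /\ p <= b].

Lemma le_diagonal (b c : B) :
  c <= diagonal b <-> forall p, atom p -> p <= b -> c <= p.
Proof.
split=> [/(le_bigmeet cB) cb p pat pb|cb]; first exact: cb.
by apply/(le_bigmeet cB) => p [pat pb]; apply: cb.
Qed.

Lemma diagonal_galois : galois diagonal.
Proof.
apply/(galoisP cB) => X c; split=> [/le_diagonal cX x Xx|cX].
  apply/le_diagonal => p pat px; apply: cX => //.
  exact: le_trans px (le_bigjoin cB Xx).
apply/le_diagonal => p pat /(atom_prime cB pcB pat)[x Xx px].
by have /le_diagonal := cX x Xx; apply.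
Qed.

Hypothesis atB : atomistic B.

Lemma diagonal_le (b c : B) : b != \bot -> c <= diagonal b -> c <= b.
Proof.
have /ABC_atomistic[_ atomicB] := atB.
move=> /atomicB[p pat pb] /le_diagonal cb.
exact: le_trans (cb p pat pb) pb.
Qed.

Lemma diagonal_sym (b c : B) : c <= diagonal b -> b <= diagonal c.
Proof.
move=> /le_diagonal cb; apply/le_diagonal => p pat pc; apply: atB => q qat qb.
by rewrite (atom_le_eq pat qat) // (le_trans pc) ?cb.
Qed.

Lemma diagonal_atom (p : B) : atom p -> p <= diagonal p.
Proof.
by move=> pat; apply/le_diagonal => q qat qp; rewrite (atom_le_eq qat pat qp).
Qed.

(** A pair of the tensor of [f] is a join of pairs with an atom as component,
    and that atom may serve as the middle element linking it to itself. *)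
Lemma diagonal_odotl (A : pcLattice) (f : A -> B) : galois f ->
  odot diagonal f =1 f.
Proof.
have cA := @pc_complete A; move=> gf a; apply/eqP; rewrite eq_le.
apply/andP; split.
  apply: (odot_least cA cB) => // y x z y0 yf zy.
  exact: le_trans (diagonal_le y0 zy) yf.
apply: atB => p pat pf; apply: (le_odot cB pat.1 pf).
exact: diagonal_atom.
Qed.

Lemma diagonal_odotr (C : pcLattice) (g : B -> C) : galois g ->
  odot g diagonal =1 g.
Proof.
have cC := @pc_complete C; move=> gg b; apply/eqP; rewrite eq_le.
apply/andP; split.
  apply: (odot_least cB cC) => // y x z y0 yx zg.
  apply: le_trans zg (galois_anti cB cC gg _).
  exact/(diagonal_le y0)/diagonal_sym.
rewrite -[b in odot _ _ b]atomistic_bigjoin //.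
apply: (le_galois_bigjoin cC (odot_galois g diagonal cB cC)) => p [pat pb].
apply: (le_odot cC pat.1 (diagonal_atom pat)).
exact: (galois_anti cB cC gg pb).
Qed.

End Diagonal.

Definition diagonal_Gal (B : pcLattice) : Gal B B :=
  exist _ diagonal diagonal_galois.

Lemma diagonal_identity (B : PCL) :
  ABC_lattice B -> is_identity (diagonal_Gal B : hom PCL B B).
Proof.
move=> /ABC_atomistic atB; split=> [A f|C g]; apply: Gal_eq.
  exact: diagonal_odotl (svalP f).
exact: diagonal_odotr (svalP g).
Qed.

Lemma has_identity_ABC (B : PCL) : has_identity B <-> ABC_lattice B.
Proof.
split=> [[[i gi] [iL iR]]|]; last first.
  by exists (diagonal_Gal B); apply: diagonal_identity.
apply/ABC_atomistic; apply: (identity_atomistic gi) => [f gf|g gg].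
  exact: (congr1 sval (iL B (exist _ f gf))).
exact: (congr1 sval (iR B (exist _ g gg))).
Qed.

(** * Atoms and relations *)

Definition ABC : semicat := full_sub PCL ABC_lattice.

Lemma ABC_category : is_category ABC.
Proof.
split=> [A B C D f g h|[B abcB]]; first exact: PCL_semicategory.
exists (diagonal_Gal B); apply: identity_full_sub; exact: diagonal_identity.
Qed.

Lemma Rel_identity (X : Rel) (i : hom Rel X X) :
  (forall x y, i (x, y) <-> x = y) -> is_identity i.
Proof.
move=> iE; split=> [W R|Y R]; apply/seteqP; split=> -[x y] /=.
- by move=> [z [xz /iE <-]].
- by move=> xy; exists y; split=> //; apply/iE.
- by move=> [z [/iE <-]].
- by move=> xy; exists x; split=> //; apply/iE.
Qed.

Lemma Rel_category : is_category Rel.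
Proof.
split=> [A B C D R S T|X].
  apply/seteqP; split=> -[x w] /=.
    by move=> [z [[y [xy yz]] zw]]; exists y; split=> //; exists z.
  by move=> [y [xy [z [yz zw]]]]; exists z; split=> //; exists y.
by exists [set p | p.1 = p.2]; apply: Rel_identity.
Qed.

Definition atoms (B : pcLattice) : Type := {p : B | atom p}.

Lemma atoms_le_eq (B : pcLattice) (p q : atoms B) : sval p <= sval q -> p = q.
Proof.
case: p q => [p pat] [q qat] /= /(atom_le_eq pat qat) pq.
exact: eq_exist.
Qed.

Definition atom_rel (A B : pcLattice) (f : Gal A B) : set (atoms A * atoms B) :=
  [set pq | sval pq.2 <= sval f (sval pq.1)].

Section AtomRel.
Context {A B C : pcLattice}.

(** The set of pairs all of whose atoms are related by the relation product is
    a tensor, since atoms are completely join prime; it contains the generating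
    pairs as soon as the nonzero middle elements have atoms below them. *)
Lemma atom_rel_comp (f : Gal A B) (g : Gal B C) : atomistic B ->
  atom_rel (Gal_comp g f) =
  [set p | exists y, atom_rel f (p.1, y) /\ atom_rel g (y, p.2)].
Proof.
have [cA cB cC] := And3 (@pc_complete A) (@pc_complete B) (@pc_complete C).
have [pcA pcC] := (@pc_pseudocomplemented A, @pc_pseudocomplemented C).
move=> /ABC_atomistic[_ atomicB]; apply/seteqP; split; last first.
  move=> [[p pat] [r rat]] [[q qat] [/= qf rg]].
  exact: (le_odot cC qat.1 qf rg).
move=> [p r] /= prgf.
pose W : set (A * C) := [set ac | forall (p : atoms A) (r : atoms C),
  sval p <= ac.1 -> sval r <= ac.2 ->
  exists q, atom_rel f (p, q) /\ atom_rel g (q, r)].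
suff Wpr : W (sval p, sval r) by exact: Wpr.
apply: (odot_ind _ _ prgf) => [|[a c] [y [/atomicB[q qat qy] yf cg]]].
  split=> [a a' c c' la lc Wac p' r' pa rc|X Z XZ p' r' /=].
    by apply: Wac; [apply: le_trans pa la|apply: le_trans rc lc].
  move=> /(atom_prime cA pcA (svalP p'))[x Xx px].
  move=> /(atom_prime cC pcC (svalP r'))[z Zz rz].
  exact: (XZ (x, z)).
move=> p' r' /= pa rc; exists (exist _ q qat); split=> /=.
  apply: le_trans qy (le_trans yf _).
  exact: (galois_anti cA cB (svalP f) pa).
apply: le_trans rc (le_trans cg _).
exact: (galois_anti cB cC (svalP g) qy).
Qed.

Lemma atom_rel_faithful (f g : Gal A B) : atomistic A -> atomistic B ->
  atom_rel f = atom_rel g -> f = g.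
Proof.
have cB := @pc_complete B; move=> atA atB.
have le_fg (f' g' : Gal A B) a :
    atom_rel f' `<=` atom_rel g' -> sval f' a <= sval g' a.
  move=> sub; apply: atB => q qat; rewrite -[a]atomistic_bigjoin //.
  move/(galoisP cB): (svalP f') => gf; move/(galoisP cB): (svalP g') => gg.
  move=> /gf qf; apply/gg => p [pat pa].
  exact: (sub (exist _ p pat, exist _ q qat)) (qf p _).
move=> fg; apply: Gal_eq => a; apply/eqP.
by rewrite eq_le !le_fg // fg.
Qed.

Lemma atom_rel_full (R : set (atoms A * atoms B)) : atomistic B ->
  exists f : Gal A B, atom_rel f = R.
Proof.
have [cA cB] := (@pc_complete A, @pc_complete B).
have [pcA pcB] := (@pc_pseudocomplemented A, @pc_pseudocomplemented B).
move=> atB.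
pose f (a : A) : B := bigjoin [set sval q | q in
  [set q : atoms B | forall p : atoms A, sval p <= a -> R (p, q)]].
have fE (q : atoms B) a :
    sval q <= f a <-> forall p : atoms A, sval p <= a -> R (p, q).
  split=> [/(atom_prime cB pcB (svalP q))[_ [q' Rq' <-]] /atoms_le_eq -> //|Rq].
  by apply: (le_bigjoin cB); exists q.
have gf : galois f.
  apply/(galoisP cB) => X c; split=> [cX x Xx|cX].
    apply: atB => q qat qc; apply/(fE (exist _ q qat)) => p px.
    have /(fE (exist _ q qat)) := le_trans qc cX; apply.
    exact: le_trans px (le_bigjoin cA Xx).
  apply: atB => q qat qc; apply/(fE (exist _ q qat)) => p.
  move=> /(atom_prime cA pcA (svalP p))[x Xx px].
  by have /(fE (exist _ q qat)) := le_trans qc (cX x Xx); apply.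
exists (exist _ f gf); apply/seteqP; split=> -[p q] /=.
  by move=> /fE; apply.
by move=> Rpq; apply/fE => p' /atoms_le_eq ->.
Qed.

End AtomRel.

Definition atoms_fobj (B : ABC) : Rel := atoms (sval B).

Definition atoms_fmap (A B : ABC) (f : hom ABC A B) :
  hom Rel (atoms_fobj A) (atoms_fobj B) := atom_rel f.

Lemma atoms_fmap_comp (A B C : ABC) (g : hom ABC B C) (f : hom ABC A B) :
  atoms_fmap (comp g f) = comp (atoms_fmap g) (atoms_fmap f).
Proof. by apply: atom_rel_comp; apply/ABC_atomistic/svalP. Qed.

Lemma atoms_fmap_identity (B : ABC) (i : hom ABC B B) :
  is_identity i -> is_identity (atoms_fmap i).
Proof.
case: B i => B abcB i idi.
have -> : i = diagonal_Gal B.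
  apply: identity_unique idi _; apply: identity_full_sub.
  exact: diagonal_identity.
apply: Rel_identity => p q; split=> /= [|->]; last exact/diagonal_atom/svalP.
move=> /le_diagonal qp; apply/esym/atoms_le_eq; exact: qp (svalP p) (lexx _).
Qed.

Definition atoms_functor : functor ABC Rel :=
  Functor atoms_fmap_comp atoms_fmap_identity.

(** * Powersets *)

Section Powerset.
Context {X : Type}.

Lemma powerset_complete : complete_lattice (set X).
Proof.
move=> Y; exists (\bigcup_(y in Y) y); split=> [y Yy|y uby].
  by apply/subsetPset => x yx; exists y.
apply/subsetPset => x [z Yz zx].
by have /subsetPset := uby z Yz; apply.
Qed.

Lemma powerset_pseudocomplemented : pseudocomplemented (set X).
Proof.
move=> Y; exists (~` Y)%classic; split=> [|Z YZ]; first exact: setICr.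
by apply/subsetPset/disjoints_subset; rewrite setIC.
Qed.

Definition powerset : pcLattice :=
  PcLattice powerset_complete powerset_pseudocomplemented.

Lemma singleton_atom (x : X) : atom ([set x] : powerset).
Proof.
split=> [|Y /subsetPset]; first by apply/set0P; exists x.
by move=> /subset_set1.
Qed.

Lemma atom_singleton (p : powerset) (x : X) : atom p -> p x -> p = [set x].
Proof.
move=> pat px; apply/esym/(atom_le_eq (singleton_atom x) pat).
by apply/subsetPset => _ ->.
Qed.

Lemma powerset_ABC : ABC_lattice powerset.
Proof.
apply/ABC_atomistic => u v uv; apply/subsetPset => x ux.
have /subsetPset : ([set x] : powerset) <= v.
  by apply: uv (singleton_atom x) _; apply/subsetPset => _ ->.
exact.
Qed.

End Powerset.

(** The isomorphism relates the atom [[set x]] with [x]. *)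
Lemma atoms_ess_surjective (X : Rel) :
  exists (B : ABC) (e : hom Rel (atoms_functor B) X), is_iso e.
Proof.
exists (exist _ powerset (@powerset_ABC X)).
exists [set px : atoms (@powerset X) * X | sval px.1 px.2].
exists [set xp : X * atoms (@powerset X) | sval xp.2 xp.1].
split; apply: Rel_identity.
  move=> p q; split=> /= [[x [px qx]]|<-].
    apply: atoms_le_eq.
    by rewrite (atom_singleton (svalP p) px) (atom_singleton (svalP q) qx).
  have [/set0P[x px] _] := svalP p; by exists x.
move=> x y; split=> /= [[p [px py]]|<-].
  by move: py; rewrite (atom_singleton (svalP p) px) => ->.
by exists (exist _ [set x] (singleton_atom x)).
Qed.

Theorem corollary10p1 :
  is_semicategory PCL /\
  (forall B : PCL, has_identity B <-> ABC_lattice B) /\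
  equivalent_categories (full_sub PCL ABC_lattice) Rel.
Proof.
split; first exact: PCL_semicategory.
split; first exact: has_identity_ABC.
apply: (@fully_faithful_equivalence _ _ atoms_functor).
- move=> A B f g; apply: atom_rel_faithful; exact/ABC_atomistic/svalP.
- move=> A B R; apply: atom_rel_full; exact/ABC_atomistic/svalP.
- exact: atoms_ess_surjective.
- exact: ABC_category.
- exact: Rel_category.
Qed.
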